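(* Let $n\ge 1$, let $w_1,\ldots,w_n$ be positive real numbers with $\sum_{j=1}^n w_j\ge 1$, and let $p_1,\ldots,p_n$ be real numbers with $p_j>0$ for all $j=1,\ldots,n$. Let $b_0:=1$ and $b_k:=\sum_{j=1}^n w_jk^{p_j}$ for $k\ge 1$. Then $\lim_{k\to\infty}b_k^{1/k}=1$. *)

(* Defs.v *)
From mathcomp Require Import all_boot all_order all_algebra.
From mathcomp Require Import all_classical all_reals all_analysis.

Set Implicit Arguments.
Unset Strict Implicit.
Unset Printing Implicit Defensive.

Import GRing.Theory.
Local Open Scope ring_scope.

Definition b_seq (R : realType) (n : nat) (w p : 'I_n -> R) (k : nat) : R :=
  if k == 0%N then 1 else \sum_(j < n) w j * k%:R `^ p j.

(* Main.v *)
Require Import Defs.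
From mathcomp Require Import all_boot all_order all_algebra.
From mathcomp Require Import all_classical all_reals all_analysis.
From mathcomp Require Import lra.
Import Order.TTheory GRing.Theory Num.Theory.
Import numFieldNormedType.Exports.
Local Open Scope classical_set_scope.
Local Open Scope ring_scope.

(* For [k >= 1] and [P] the sum of the [p j], [1 <= b_k <= (\sum_j w j) k ^ P].
   Hence [0 <= ln b_k / k <= ln (\sum_j w j) / k + P ln k / k], which tends to
   [0], and [b_k ^ (1/k) = exp (ln b_k / k)] tends to [1]. *)

Lemma natV_cvg0 (R : realType) : (fun k : nat => (k%:R : R)^-1) @ \oo --> (0 : R).
(* The shift drops index [0], where the inverse is [0] by convention, and leaves the harmonic
   sequence [1 / (k + 1)]. *)
Proof. by rewrite -cvg_shiftS; exact: cvg_harmonic. Qed.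

(** With [s = Num.sqrt x], [ln x = 2 ln s] and [ln s <= s - 1 <= s]. Growth slower than linear is
    what makes [ln k / k] vanish. *)
Lemma ln_le_sqrt (R : realType) (x : R) : 0 < x -> ln x <= 2 * Num.sqrt x.
Proof.
move=> x0; have s0 : 0 < Num.sqrt x by rewrite sqrtr_gt0.
rewrite -{1}(sqr_sqrtr (ltW x0)) lnXn// -[ln _ *+ _]mulr_natl ler_pM2l//.
have : -1 < Num.sqrt x - 1 by lra.
by move=> /le_ln1Dx; rewrite addrC subrK => /le_trans; apply; lra.
Qed.

Lemma ln_nat_div_cvg0 (R : realType) :
  (fun k : nat => ln (k%:R : R) / k%:R) @ \oo --> (0 : R).
Proof.
apply: (@squeeze_cvgr _ _ _ _ (cst 0) (fun k => 2 * Num.sqrt (k%:R^-1))).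
- near=> k.
  have k1 : (1 <= k)%N by near: k; exists 1%N.
  have k0 : 0 < k%:R :> R by rewrite ltr0n.
  rewrite divr_ge0 ?ln_ge0 ?ler1n //=.
  rewrite ler_pdivrMr// (le_trans (ln_le_sqrt _ _ k0))// -mulrA ler_pM2l//.
  (* Writing [k] as the square of its root cancels one factor of [Num.sqrt k] against the inverse
     root. *)
  rewrite sqrtrV ?(ltW k0)// -[X in _ * X](sqr_sqrtr (ltW k0)) expr2 mulKf//.
  by rewrite gt_eqF// sqrtr_gt0.
- exact: cvg_cst.
- rewrite -[0 in X in _ --> X](mulr0 2); apply: cvgMr.
  rewrite -sqrtr0; apply: (@cvg_comp _ _ _ _ Num.sqrt _ _ _ (natV_cvg0 R)).
  exact: sqrt_continuous.
Unshelve. all: by end_near.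
Qed.

(** For [k >= 1] each power satisfies [k ^ p j >= k ^ 0 = 1]. *)
Lemma b_seq_ge (R : realType) (n : nat) (w p : 'I_n -> R) (k : nat) :
  (forall j, 0 <= w j) -> (forall j, 0 <= p j) -> (0 < k)%N ->
  \sum_(j < n) w j <= b_seq w p k.
Proof.
move=> w0 p0 k0; rewrite /b_seq gtn_eqF//; apply: ler_sum => j _.
have k1 : 1 <= k%:R :> R by rewrite ler1n.
by rewrite ler_peMr// -[leLHS](powRr0 k%:R) ler_powR.
Qed.

(** Each [p j] is at most the sum of all exponents, since the others are nonnegative. The sum serves
    as a common exponent in place of the maximum. *)
Lemma b_seq_le (R : realType) (n : nat) (w p : 'I_n -> R) (k : nat) :
  (forall j, 0 <= w j) -> (forall j, 0 <= p j) -> (0 < k)%N ->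
  b_seq w p k <= (\sum_(j < n) w j) * k%:R `^ (\sum_(j < n) p j).
Proof.
move=> w0 p0 k0; rewrite /b_seq gtn_eqF// mulr_suml; apply: ler_sum => j _.
rewrite ler_wpM2l//; apply: ler_powR; first by rewrite ler1n.
by rewrite (bigD1 j)//= lerDl sumr_ge0.
Qed.

Theorem corollary2 (R : realType) (n : nat) (w p : 'I_n -> R)
  (hn : (1 <= n)%N)
  (w_gt0 : forall j : 'I_n, 0 < w j)
  (w_sum : 1 <= \sum_(j < n) w j)
  (p_gt0 : forall j : 'I_n, 0 < p j) :
  (fun k : nat => b_seq w p k `^ (k%:R^-1)) @ \oo --> (1 : R).
Proof.
set W := \sum_(j < n) w j in w_sum; set P := \sum_(j < n) p j.
have W0 : 0 < W by exact: lt_le_trans w_sum.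
have w0 j : 0 <= w j by exact: ltW.
have p0 j : 0 <= p j by exact: ltW.
have b1 k : (0 < k)%N -> 1 <= b_seq w p k.
  by move=> k0; exact: le_trans w_sum (b_seq_ge _ _ _ _ _ w0 p0 k0).
have ln_b : (fun k : nat => ln (b_seq w p k) / k%:R) @ \oo --> (0 : R).
  apply: (@squeeze_cvgr _ _ _ _ (cst 0)
    (fun k : nat => ln W * k%:R^-1 + P * (ln k%:R / k%:R))).
  - near=> k.
    have k0 : (0 < k)%N by near: k; exists 1%N.
    have kR0 : 0 < k%:R :> R by rewrite ltr0n.
    rewrite divr_ge0 ?ln_ge0 ?b1//= mulrA -mulrDl ler_pM2r ?invr_gt0//.
    (* [ln W + P ln k] is recombined into [ln (W k ^ P)], so that monotonicity of [ln] reduces the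
       bound to [b_seq_le]. *)
    rewrite -ln_powR -lnM ?posrE ?powR_gt0// ler_ln ?posrE.
    + exact: b_seq_le.
    + exact: lt_le_trans (b1 _ k0).
    + by rewrite mulr_gt0// powR_gt0.
  - exact: cvg_cst.
  - rewrite -[0 in X in _ --> X](addr0 0); apply: cvgD.
    + by rewrite -[0 in X in _ --> X](mulr0 (ln W)); apply: cvgMr; exact: natV_cvg0.
    + by rewrite -[0 in X in _ --> X](mulr0 P); apply: cvgMr; exact: ln_nat_div_cvg0.
rewrite -[1 in X in _ --> X](@expR0 R).
have := @cvg_comp _ _ _ _ expR _ _ _ ln_b (@continuous_expR R 0).
(* The two sequences are compared for [k >= 1], where [b_k >= 1 > 0] lets [expR] undo [ln]. *)
apply: cvg_trans; apply: near_eq_cvg; near=> k.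
have k0 : (0 < k)%N by near: k; exists 1%N.
by rewrite /= expRM lnK// posrE (lt_le_trans _ (b1 _ k0)).
Unshelve. all: by end_near.
Qed.
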